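(* In the worst case scenario, the computational cost of linear optimal control (linear OC) scales $m_T^{1.5}$ times larger than that of linear model-predictive control (linear MPC), where $m_T$ is the number of time samples.
   Context: A discretized gas network has $E$ edges, $V_w$ withdrawal nodes and $C$ compressors (a set $\mathcal C$ of edges, $|\mathcal C|=C$). The horizon $[0,T]$ is divided into $m_T$ segments $(t_{m-1},t_m]$, $m=1,\dots,m_T$. At each sampling time $t_m$ the decision variables are the withdrawal-node densities $\boldsymbol\rho(t_m)\in\mathbb R^{V_w}$, the edge mass fluxes $\varphi(t_m)\in\mathbb R^{E}$ and the compressor ratios $\mu_k(t_m)$, $k\in\mathcal C$. The linear objective at $t_m$ is $$\mathcal J(t_m)=\sum_{k\in\mathcal C}c_k\varphi_k(t_m)\left(\overline\mu_k^{(\gamma-1)/\gamma}-1\right)+\sum_{k\in\mathcal C}c_k\left(\tfrac{\gamma-1}{\gamma}\overline\varphi_k\overline\mu_k^{-1/\gamma}\right)\mu_k(t_m),$$ with given constants $c_k,\gamma$ and nominal values $\overline\varphi_k,\overline\mu_k$. The constraints at $t_m$ are box constraints $\boldsymbol\rho^{\min}\le\boldsymbol\rho(t_m)\le\boldsymbol\rho^{\max}$, $\varphi^{\min}\le\varphi(t_m)\le\varphi^{\max}$, $1\le\mu_k(t_m)\le\mu_k^{\max}$, together with the implicit discretization over $(t_{m-1},t_m]$ of a linearized dynamical system $\frac{d}{dt}(\boldsymbol\rho,\varphi)=\overline f(\boldsymbol\rho,\varphi,\mu)$ with $\overline f$ affine, i.e. $(\boldsymbol\rho(t_m),\varphi(t_m))=(\boldsymbol\rho(t_{m-1}),\varphi(t_{m-1}))+(t_m-t_{m-1})\overline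 f(\boldsymbol\rho(t_m),\varphi(t_m),\mu(t_m))$. Linear MPC: for $m=1,\dots,m_T$ successively, solve the single-segment linear program minimizing $\mathcal J(t_m)$ over the $E+V_w+C$ variables at time $t_m$ subject to the constraints at $t_m$ (the state at $t_{m-1}$ being the already computed nominal state); then update the nominal values and the linear system with the solution and pass to the next segment. Its computational cost is accumulated over its $m_T$ linear programs. Linear OC: solve one linear program minimizing $\sum_{m=1}^{m_T}\mathcal J(t_m)$ over all $m_T(E+V_w+C)$ variables at all times $t_1,\dots,t_{m_T}$ simultaneously, subject to all the constraints for $m=1,\dots,m_T$ (with a fixed linear system). Worst-case cost: the result is based on the known fact (Vaidya, 1989) that a worst-case computational complexity for a linear optimization program scales as $\mathcal O(n^{2.5})$, where $n$ is the number of optimization variables. With this, the cost of linear OC scales as $\mathcal O(m_T^{2.5}(E+V_w+C)^{2.5})$ and that of linear MPC as $\mathcal O(m_T(E+V_w+C)^{2.5})$; the comparison in the claim is between these scalings. *)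

(* Defs.v *)
From HB Require Import structures.
From mathcomp Require Import all_boot all_order all_algebra.
From mathcomp Require Import all_classical all_reals all_analysis.

Set Implicit Arguments.
Unset Strict Implicit.
Unset Printing Implicit Defensive.
Import Order.TTheory GRing.Theory Num.Theory.
Import numFieldNormedType.Exports.
Local Open Scope classical_set_scope.
Local Open Scope ring_scope.

Record lp (R : realType) := Lp {
  lp_var : finType;
  lp_eq : finType;
  lp_le : finType;
  lp_obj : lp_var -> R;
  lp_eq_coef : lp_eq -> lp_var -> R;
  lp_eq_rhs : lp_eq -> R;
  lp_le_coef : lp_le -> lp_var -> R;
  lp_le_rhs : lp_le -> R }.

Definition lp_nvars (R : realType) (P : lp R) : nat := #|lp_var P|.

Definition lp_value (R : realType) (P : lp R) (x : lp_var P -> R) : R :=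
  \sum_v lp_obj v * x v.

Definition lp_feasible (R : realType) (P : lp R) (x : lp_var P -> R) : Prop :=
  (forall i : lp_eq P, \sum_v lp_eq_coef i v * x v = lp_eq_rhs i) /\
  (forall i : lp_le P, \sum_v lp_le_coef i v * x v <= lp_le_rhs i).

Definition lp_optimal (R : realType) (P : lp R) (x : lp_var P -> R) : Prop :=
  lp_feasible x /\ forall y : lp_var P -> R, lp_feasible y -> lp_value x <= lp_value y.

(* [solve P] is unconstrained when [P] has no optimal solution. *)
Record lp_solver (R : realType) := LpSolver {
  solve : forall P : lp R, lp_var P -> R;
  cost : lp R -> R;
  cost_ge0 : forall P, 0 <= cost P;
  solve_optimal : forall (P : lp R) (x : lp_var P -> R),
    lp_optimal x -> lp_optimal (@solve P) }.

Arguments solve {R} S P _ : rename.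

Definition costs_of_size (R : realType) (S : lp_solver R) (n : nat) : set R :=
  [set r | exists2 P : lp R, lp_nvars P = n & cost S P = r].

Definition worst_case (R : realType) (S : lp_solver R) (n : nat) : R :=
  sup (costs_of_size S n).

Definition vaidya_rate (R : realType) (n : nat) : R := n%:R `^ (5 / 2).

(* Boundedness is needed because the real-valued [sup] of an unbounded set is
   a default value. *)
Definition vaidya_bound (R : realType) (S : lp_solver R) : Prop :=
  (forall n, has_ubound (costs_of_size S n)) /\
  worst_case S =O_\oo (@vaidya_rate R).

Definition run_cost (R : realType) (S : lp_solver R) (ps : seq (lp R)) : R :=
  \sum_(P <- ps) cost S P.

(* Every program of the run is charged the worst case for its size. *)
Definition worst_run_cost (R : realType) (S : lp_solver R) (ps : seq (lp R)) : R :=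
  \sum_(P <- ps) worst_case S (lp_nvars P).

Definition run_scaling (R : realType) (ps : seq (lp R)) : R :=
  \sum_(P <- ps) vaidya_rate R (lp_nvars P).

Definition state_index (Vw E : nat) : finType := ('I_Vw + 'I_E)%type.

Definition compressor (E : nat) (C : {set 'I_E}) : finType :=
  {k : 'I_E | k \in C}.

Definition step_var (Vw E : nat) (C : {set 'I_E}) : finType :=
  (state_index Vw E + compressor C)%type.

Section StepVar.
Variables (Vw E : nat) (C : {set 'I_E}).
Definition rho_var (i : 'I_Vw) : step_var Vw C := inl (inl i).
Definition phi_var (e : 'I_E) : step_var Vw C := inl (inr e).
Definition mu_var (k : compressor C) : step_var Vw C := inr k.
Definition state_var (s : state_index Vw E) : step_var Vw C := inl s.
End StepVar.

Record affine_system (R : realType) (Vw E : nat) (C : {set 'I_E}) := AffineSystem {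
  aff_mx : state_index Vw E -> step_var Vw C -> R;
  aff_cst : state_index Vw E -> R }.

Definition affine_eval (R : realType) (Vw E : nat) (C : {set 'I_E})
    (f : affine_system R Vw C) (x : step_var Vw C -> R) (s : state_index Vw E) : R :=
  \sum_v aff_mx f s v * x v + aff_cst f s.

(* [linearize x] is the affine right-hand side obtained by linearizing the
   network dynamics about the nominal point [x]; the way it depends on [x] is
   left arbitrary.  [nominal0] is the nominal point at time [t_0], whose state
   part is the initial state; [nominal_oc] is the fixed nominal point used by
   linear OC. *)
Record gas_problem (R : realType) := GasProblem {
  n_wnodes : nat;
  n_edges : nat;
  compressors : {set 'I_n_edges};
  horizon : R;
  n_samples : nat;
  time : nat -> R;
  horizon_gt0 : 0 < horizon;
  time_start : time 0 = 0;
  time_end : time n_samples = horizon;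
  time_lt : forall m, (m < n_samples)%N -> time m < time m.+1;
  gamma : R;
  obj_cst : compressor compressors -> R;
  rho_min : 'I_n_wnodes -> R;
  rho_max : 'I_n_wnodes -> R;
  phi_min : 'I_n_edges -> R;
  phi_max : 'I_n_edges -> R;
  mu_max : compressor compressors -> R;
  linearize : (step_var n_wnodes compressors -> R) ->
    affine_system R n_wnodes compressors;
  nominal0 : step_var n_wnodes compressors -> R;
  nominal_oc : step_var n_wnodes compressors -> R }.

Arguments linearize {R} I _ : rename.
Arguments nominal0 {R} I _ : rename.
Arguments nominal_oc {R} I _ : rename.

Section Problem.
Context {R : realType}.
Variable I : gas_problem R.

Notation comp := (compressor (compressors I)).
Notation sidx := (state_index (n_wnodes I) (n_edges I)).
Notation var := (step_var (n_wnodes I) (compressors I)).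
Notation rho := (@rho_var (n_wnodes I) (n_edges I) (compressors I)).
Notation phi := (@phi_var (n_wnodes I) (n_edges I) (compressors I)).
Notation mu := (@mu_var (n_wnodes I) (n_edges I) (compressors I)).
Notation st := (@state_var (n_wnodes I) (n_edges I) (compressors I)).
Notation g := (gamma I).

Definition step_size : nat := (n_edges I + n_wnodes I + #|compressors I|)%N.

Definition step_length (m : nat) : R := time I m.+1 - time I m.

(* J at one sampling time, linearized about the nominal point [nom]. *)
Definition step_cost (nom x : var -> R) : R :=
  \sum_(k : comp) obj_cst k * x (phi (val k)) *
    (nom (mu k) `^ ((g - 1) / g) - 1) +
  \sum_(k : comp) obj_cst k *
    ((g - 1) / g * nom (phi (val k)) * nom (mu k) `^ (- 1 / g)) * x (mu k).

Definition step_obj (nom : var -> R) (v : var) : R :=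
  match v with
  | inl (inl _) => 0
  | inl (inr e) =>
      if insub e is Some k then
        obj_cst (k : comp) * (nom (mu k) `^ ((g - 1) / g) - 1)
      else 0
  | inr k =>
      obj_cst k * ((g - 1) / g * nom (phi (val k)) * nom (mu k) `^ (- 1 / g))
  end.

Definition lower_bound (v : var) : R :=
  match v with
  | inl (inl i) => rho_min i
  | inl (inr e) => phi_min e
  | inr _ => 1
  end.

Definition upper_bound (v : var) : R :=
  match v with
  | inl (inl i) => rho_max i
  | inl (inr e) => phi_max e
  | inr k => mu_max k
  end.

(* Program of the segment (t_m, t_{m+1}]: both the linearization and the state
   at t_m are taken from the nominal point [nom].  A row [inl v] of the
   inequalities is the lower bound on [v], a row [inr v] the upper bound. *)
Definition mpc_lp (nom : var -> R) (m : nat) : lp R :=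
  let f := linearize I nom in
  {| lp_var := var; lp_eq := sidx; lp_le := (var + var)%type;
     lp_obj := step_obj nom;
     lp_eq_coef := fun s v => (v == st s)%:R - step_length m * aff_mx f s v;
     lp_eq_rhs := fun s => nom (st s) + step_length m * aff_cst f s;
     lp_le_coef := fun i v =>
       match i with inl w => - (v == w)%:R | inr w => (v == w)%:R end;
     lp_le_rhs := fun i =>
       match i with inl w => - lower_bound w | inr w => upper_bound w end |}.

Fixpoint mpc_nominal (S : lp_solver R) (m : nat) : var -> R :=
  if m is m'.+1 then solve S (mpc_lp (mpc_nominal S m') m') else nominal0 I.

Definition mpc_programs (S : lp_solver R) : seq (lp R) :=
  [seq mpc_lp (mpc_nominal S m) m | m <- iota 0 (n_samples I)].

(* The variable [(m, v)] is [v] at time t_{m+1}. *)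
Definition oc_var : finType := ('I_(n_samples I) * var)%type.

Definition oc_lp : lp R :=
  let nom := nominal_oc I in
  let f := linearize I nom in
  {| lp_var := oc_var;
     lp_eq := ('I_(n_samples I) * sidx)%type;
     lp_le := (oc_var + oc_var)%type;
     lp_obj := fun p : oc_var => step_obj nom p.2;
     lp_eq_coef := fun (i : 'I_(n_samples I) * sidx) (p : oc_var) =>
       (p.1 == i.1)%:R *
         ((p.2 == st i.2)%:R - step_length i.1 * aff_mx f i.2 p.2)
       - (p.1.+1 == i.1 :> nat)%:R * (p.2 == st i.2)%:R;
     lp_eq_rhs := fun i : 'I_(n_samples I) * sidx =>
       (if val i.1 == 0 then nominal0 I (st i.2) else 0)
       + step_length i.1 * aff_cst f i.2;
     lp_le_coef := fun i p =>
       match i with inl w => - (p == w)%:R | inr w => (p == w)%:R end;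
     lp_le_rhs := fun i =>
       match i with
       | inl w => - lower_bound w.2
       | inr w => upper_bound w.2
       end |}.

Definition oc_programs : seq (lp R) := [:: oc_lp].

Definition box_ok (x : var -> R) : Prop :=
  [/\ forall i, rho_min i <= x (rho i) <= rho_max i,
      forall e, phi_min e <= x (phi e) <= phi_max e &
      forall k, 1 <= x (mu k) <= mu_max k].

Definition euler_ok (f : affine_system R (n_wnodes I) (compressors I)) (m : nat)
    (x0 : sidx -> R) (x : var -> R) : Prop :=
  forall s, x (st s) = x0 s + step_length m * affine_eval f x s.

Lemma sum_delta (T : finType) (w : T) (x : T -> R) :
  \sum_v (v == w)%:R * x v = x w.
Proof.
rewrite (bigD1 w) //= eqxx mul1r big1 ?addr0 // => v /negPf ->.
by rewrite mul0r.
Qed.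

Lemma sum_deltaN (T : finType) (w : T) (x : T -> R) :
  \sum_v - (v == w)%:R * x v = - x w.
Proof.
by rewrite -[in RHS](sum_delta w x) -sumrN; apply: eq_bigr => v _; rewrite mulNr.
Qed.

Lemma sum_pair (T U : finType) (F : T * U -> R) :
  \sum_p F p = \sum_t \sum_u F (t, u).
Proof. by rewrite pair_bigA; apply: eq_bigr => -[]. Qed.

Lemma step_objE (nom x : var -> R) :
  \sum_v step_obj nom v * x v = step_cost nom x.
Proof.
rewrite big_sumType/= big_sumType/= [X in X + _ + _]big1 ?add0r; last first.
  by move=> i _; rewrite mul0r.
rewrite /step_cost; congr (_ + _).
rewrite (bigID (mem (compressors I)))/= [X in _ + X]big1 ?addr0; last first.
  by move=> e eC; rewrite insubF ?mul0r //; exact/negbTE.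
rewrite (reindex_omap (val : comp -> 'I_(n_edges I)) insub)/=; last first.
  by move=> e eC; rewrite insubT.
apply: eq_big => k; first by rewrite valK eqxx andbT (valP k).
by move=> _; rewrite valK mulrAC.
Qed.

Lemma box_okE (x : var -> R) :
  box_ok x <-> forall v, lower_bound v <= x v <= upper_bound v.
Proof.
split=> [[h1 h2 h3] [[i|e]|k]|h]; [exact: h1|exact: h2|exact: h3|].
split=> [i|e|k]; [exact: (h (rho i))|exact: (h (phi e))|exact: (h (mu k))].
Qed.

Lemma mpc_feasibleP (nom : var -> R) (m : nat) (x : var -> R) :
  @lp_feasible R (mpc_lp nom m) x <->
  box_ok x /\ euler_ok (linearize I nom) m (nom \o st) x.
Proof.
rewrite box_okE /lp_feasible /=.
have E s : \sum_(v : var) ((v == st s)%:R -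
      step_length m * aff_mx (linearize I nom) s v) * x v =
    x (st s) - step_length m * \sum_v aff_mx (linearize I nom) s v * x v.
  rewrite -[in RHS](sum_delta (st s)) mulr_sumr -sumrB; apply: eq_bigr => v _.
  by rewrite mulrBl mulrA.
split=> [[h1 h2]|[h1 h2]]; split.
- move=> v; apply/andP; split.
    by have := h2 (inl v); rewrite sum_deltaN lerN2.
  by have := h2 (inr v); rewrite sum_delta.
- move=> s; have := h1 s; rewrite E /affine_eval => /eqP.
  by rewrite subr_eq => /eqP ->; rewrite /= mulrDr -addrA [X in _ + X]addrC.
- move=> s; rewrite E h2 /affine_eval /= mulrDr addrA.
  by rewrite [X in X - _]addrAC addrK.
- case=> v; have /andP[a b] := h1 v; last by rewrite sum_delta.
  by rewrite sum_deltaN lerN2.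
Qed.

Lemma mpc_valueE (nom : var -> R) (m : nat) (x : var -> R) :
  @lp_value R (mpc_lp nom m) x = step_cost nom x.
Proof. exact: step_objE. Qed.

(* State at t_m for the segment (t_m, t_{m+1}]; the last branch is unreachable. *)
Definition oc_prev (x : oc_var -> R) (m : 'I_(n_samples I)) (s : sidx) : R :=
  match val m with
  | 0 => nominal0 I (st s)
  | m'.+1 => if insub m' is Some j then x (j, st s) else 0
  end.

Lemma oc_feasibleP (x : oc_var -> R) :
  @lp_feasible R oc_lp x <->
  forall m : 'I_(n_samples I), box_ok (fun v => x (m, v)) /\
    euler_ok (linearize I (nominal_oc I)) m (oc_prev x m) (fun v => x (m, v)).
Proof.
rewrite /lp_feasible /=; set f := linearize _ _.
have E (m : 'I_(n_samples I)) s :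
    (\sum_(p : oc_var) ((p.1 == m)%:R *
         ((p.2 == st s)%:R - step_length m * aff_mx f s p.2)
       - (p.1.+1 == m :> nat)%:R * (p.2 == st s)%:R) * x p ==
      (if val m == 0 then nominal0 I (st s) else 0)
       + step_length m * aff_cst f s) =
    (x (m, st s) ==
      oc_prev x m s + step_length m * affine_eval f (fun v => x (m, v)) s).
  under eq_bigr do rewrite mulrBl.
  rewrite sumrB.
  have -> : \sum_(p : oc_var) (p.1 == m)%:R *
      ((p.2 == st s)%:R - step_length m * aff_mx f s p.2) * x p =
      x (m, st s) - step_length m * \sum_v aff_mx f s v * x (m, v).
    rewrite sum_pair /=.
    rewrite (bigD1 m)//= [X in _ + X]big1 ?addr0; last first.
      move=> j /negPf jm; rewrite big1// => v _.
      by rewrite jm !mul0r.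
    rewrite -[in RHS](sum_delta (st s) (fun v => x (m, v))) mulr_sumr -sumrB.
    by apply: eq_bigr => v _; rewrite eqxx mul1r mulrBl mulrA.
  have -> : \sum_(p : oc_var) (p.1.+1 == m :> nat)%:R * (p.2 == st s)%:R * x p =
      oc_prev x m s - (if val m == 0 then nominal0 I (st s) else 0).
    rewrite sum_pair /=.
    have H (j : 'I_(n_samples I)) : \sum_v (j.+1 == m :> nat)%:R * (v == st s)%:R * x (j, v) =
        (j.+1 == m :> nat)%:R * x (j, st s).
      rewrite -[x (j, st s)](sum_delta (st s) (fun v => x (j, v))) mulr_sumr.
      by apply: eq_bigr => v _; rewrite mulrA.
    under eq_bigr do rewrite H.
    rewrite /oc_prev; case: m {H} => -[|m] mlt /=.
      by rewrite subrr big1 // => j _; rewrite mul0r.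
    rewrite subr0 insubT; first exact: ltnW.
    move=> mlt'; rewrite -[RHS](sum_delta _ (fun j => x (j, st s))).
    by apply: eq_bigr => j _.
  rewrite /affine_eval mulrDr.
  set A := step_length _ * _; set B := step_length _ * _.
  set z := (if _ then _ else _).
  rewrite -subr_eq0 -[RHS]subr_eq0; congr (_ == _).
  rewrite !opprD !opprK !addrA.
  by rewrite [LHS](ACl (1*3*2*5*4*6)) /= subrK.
split=> [[h1 h2] m|h]; split.
- apply/box_okE => v; apply/andP; split.
    by have := h2 (inl (m, v)); rewrite sum_deltaN lerN2.
  by have := h2 (inr (m, v)); rewrite sum_delta.
- by move=> s; apply/eqP; rewrite -E; apply/eqP; exact: (h1 (m, s)).
- by move=> [m s]; apply/eqP; rewrite E; apply/eqP; have [_] := h m; exact.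
- case=> -[m v]; have [/box_okE/(_ v)/andP[a b] _] := h m; last by rewrite sum_delta.
  by rewrite sum_deltaN lerN2.
Qed.

Lemma oc_valueE (x : oc_var -> R) :
  @lp_value R oc_lp x =
  \sum_(m < n_samples I) step_cost (nominal_oc I) (fun v => x (m, v)).
Proof.
rewrite /lp_value /=.
rewrite sum_pair /=.
by apply: eq_bigr => m _; exact: step_objE.
Qed.

End Problem.

(* Main.v *)
(* Linear OC is one program of size m s and linear MPC is m programs of size s,
   with s = E + V_w + C, and (m s)^(5/2) = m^(3/2) * (m * s^(5/2)).  The
   O-bound holds only beyond some size N; since the rate is at least 1 at every
   positive size, adding the worst cases of all sizes below N to the constant
   makes it hold at all of them. *)
Require Import Defs.
From HB Require Import structures.
From mathcomp Require Import all_boot all_order all_algebra.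
From mathcomp Require Import all_classical all_reals all_analysis.
From mathcomp Require Import lra.
Import Order.TTheory GRing.Theory Num.Theory.
Import numFieldNormedType.Exports.
Local Open Scope classical_set_scope.
Local Open Scope ring_scope.

Section WorstCase.
Context {R : realType}.
Implicit Types (S : lp_solver R) (ps : seq (lp R)).

Lemma vaidya_rate_ge0 n : 0 <= vaidya_rate R n.
Proof. exact: powR_ge0. Qed.

Lemma vaidya_rate_ge1 n : (0 < n)%N -> 1 <= vaidya_rate R n.
Proof.
move=> n0; rewrite /vaidya_rate -{1}(powRr0 (n%:R : R)).
by rewrite ler_powR ?ler1n// divr_ge0.
Qed.

Lemma vaidya_rateM m n :
  vaidya_rate R (m * n)%N = vaidya_rate R m * vaidya_rate R n.
Proof. by rewrite /vaidya_rate natrM powRM. Qed.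

Lemma vaidya_rate_split n : vaidya_rate R n = n%:R `^ (3 / 2) * n%:R.
Proof.
have e : (5 / 2 = 3 / 2 + 1 :> R) by lra.
(* The side condition of [powRD] only concerns exponents with sum 0; here the sum is 5/2, so the
   base 0 is covered too. *)
by rewrite /vaidya_rate e powRD ?powRr1//; apply/implyP; lra.
Qed.

Lemma worst_case_ge0 S n : 0 <= worst_case S n.
Proof.
have [[[_ [P Pn _]] ubS]|noS] := pselect (has_sup (costs_of_size S n)).
  by rewrite (le_trans (cost_ge0 S P))//; apply: ub_le_sup => //; exists P.
(* An empty or unbounded set of costs has the default supremum 0. *)
by rewrite /worst_case sup_out.
Qed.

Lemma cost_le_worst_case S (P : lp R) : vaidya_bound S ->
  cost S P <= worst_case S (lp_nvars P).
Proof. by move=> [ubS _]; apply: ub_le_sup => //; exists P. Qed.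

Lemma run_cost_le_worst S ps : vaidya_bound S ->
  run_cost S ps <= worst_run_cost S ps.
Proof. by move=> hS; apply: ler_sum => P _; exact: cost_le_worst_case. Qed.

Lemma worst_case_le_rate S : vaidya_bound S ->
  exists2 K : R, 0 < K &
    forall n, (0 < n)%N -> worst_case S n <= K * vaidya_rate R n.
Proof.
move=> [_ /eqO_exP[K K0 [N _ KN]]].
exists (K + \sum_(i < N) worst_case S i).
  by rewrite ltr_wpDr// sumr_ge0// => i _; exact: worst_case_ge0.
move=> n n0; rewrite mulrDl; have [Nn|nN] := leqP N n.
  have := KN n Nn; rewrite !ger0_norm ?vaidya_rate_ge0 ?worst_case_ge0// => /le_trans.
  apply; rewrite lerDl mulr_ge0 ?vaidya_rate_ge0// sumr_ge0// => i _.
  exact: worst_case_ge0.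
rewrite ler_wpDl ?mulr_ge0 ?vaidya_rate_ge0 ?(ltW K0)//.
rewrite (@le_trans _ _ (\sum_(i < N) worst_case S i))//.
  rewrite (bigD1 (Ordinal nN))//= lerDl sumr_ge0// => i _.
  exact: worst_case_ge0.
rewrite ler_peMr ?vaidya_rate_ge1// sumr_ge0// => i _.
exact: worst_case_ge0.
Qed.

(** Both functions are nonnegative, so the norms in the Theta relation drop out, leaving explicit
    constants and a threshold. *)
Lemma worst_case_Theta S : worst_case S =Theta_\oo (@vaidya_rate R) ->
  exists (k K : R) (N : nat), [/\ 0 < k, 0 < K &
    forall n, (N <= n)%N ->
      k * vaidya_rate R n <= worst_case S n <= K * vaidya_rate R n].
Proof.
rewrite eqThetaE qualifE => /asboolP[[k K] /= /andP[k0 K0] [N _ kKN]].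
exists k, K, N; split=> // n Nn; have [] := kKN n Nn.
by rewrite !ger0_norm ?vaidya_rate_ge0 ?worst_case_ge0// => -> ->.
Qed.

End WorstCase.

Section Runs.
Context {R : realType}.
Implicit Types (S : lp_solver R) (I : gas_problem R).

(** With no sample, [time 0] would be both 0 and the positive horizon. *)
Lemma n_samples_gt0 I : (0 < n_samples I)%N.
Proof.
rewrite lt0n; apply/eqP => n0.
by have := horizon_gt0 I; rewrite -time_end n0 time_start ltxx.
Qed.

Lemma mpc_lp_nvars I nom m : lp_nvars (@mpc_lp R I nom m) = step_size I.
Proof.
rewrite /lp_nvars /= !card_sum !card_ord card_sig /step_size.
by rewrite [(n_edges I + _)%N]addnC.
Qed.

Lemma oc_lp_nvars I : lp_nvars (oc_lp I) = (n_samples I * step_size I)%N.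
Proof.
by rewrite -(mpc_lp_nvars I (nominal_oc I) 0) /lp_nvars card_prod card_ord.
Qed.

(** The weight [w] is arbitrary so that the same count serves [vaidya_rate] and [worst_case S]. *)
Lemma sum_oc_programs I (w : nat -> R) :
  \sum_(P <- oc_programs I) w (lp_nvars P) = w (n_samples I * step_size I)%N.
Proof. by rewrite big_seq1 oc_lp_nvars. Qed.

(** The nominal points depend on what the solver returned earlier, but they only change
    coefficients: every program of the run has size [step_size I]. *)
Lemma sum_mpc_programs S I (w : nat -> R) :
  \sum_(P <- mpc_programs I S) w (lp_nvars P) =
  (n_samples I)%:R * w (step_size I).
Proof.
rewrite big_map; under eq_bigr do rewrite mpc_lp_nvars.
by rewrite big_const_seq count_predT size_iota iter_addr_0 mulr_natl.
Qed.

End Runs.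

Theorem theorem4 (R : realType) (S : lp_solver R) (hS : vaidya_bound S) :
  (* the scalings of the two procedures and their comparison *)
  (forall I : gas_problem R,
     [/\ run_scaling (oc_programs I) =
           (n_samples I)%:R `^ (5 / 2) * (step_size I)%:R `^ (5 / 2),
         run_scaling (mpc_programs I S) =
           (n_samples I)%:R * (step_size I)%:R `^ (5 / 2) &
         run_scaling (oc_programs I) =
           (n_samples I)%:R `^ (3 / 2) * run_scaling (mpc_programs I S)]) /\
  (* they bound the worst-case costs, with one constant for all problems *)
  (exists2 K : R, 0 < K & forall I : gas_problem R, (0 < step_size I)%N ->
     (run_cost S (oc_programs I) <= worst_run_cost S (oc_programs I)
        <= K * ((n_samples I)%:R `^ (5 / 2) * (step_size I)%:R `^ (5 / 2))) /\
     (run_cost S (mpc_programs I S) <= worst_run_cost S (mpc_programs I S)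
        <= K * ((n_samples I)%:R * (step_size I)%:R `^ (5 / 2)))) /\
  (* when the n^2.5 rate is the exact order of the worst case, the worst-case
     costs themselves are in the ratio m_T^1.5 *)
  (worst_case S =Theta_\oo (@vaidya_rate R) ->
   exists (k K : R) (n0 : nat), [/\ 0 < k, 0 < K &
     forall I : gas_problem R, (n0 <= step_size I)%N ->
       k * (n_samples I)%:R `^ (3 / 2) * worst_run_cost S (mpc_programs I S)
         <= worst_run_cost S (oc_programs I)
         <= K * (n_samples I)%:R `^ (3 / 2) *
              worst_run_cost S (mpc_programs I S)]).
Proof.
have rateS (I : gas_problem R) :
    run_scaling (mpc_programs I S) =
    (n_samples I)%:R * vaidya_rate R (step_size I) by exact: sum_mpc_programs.
have rateO (I : gas_problem R) :
    run_scaling (oc_programs I) =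
    vaidya_rate R (n_samples I) * vaidya_rate R (step_size I).
  by rewrite -vaidya_rateM; exact: sum_oc_programs.
split=> [I|]; first by rewrite rateS rateO mulrA -vaidya_rate_split; split.
split.
  have [K K0 leK] := worst_case_le_rate _ hS; exists K => // I s0.
  rewrite !run_cost_le_worst//= /worst_run_cost sum_oc_programs sum_mpc_programs.
  split; last by rewrite mulrCA ler_wpM2l// leK.
  by rewrite (le_trans (leK _ _)) ?muln_gt0 ?n_samples_gt0// vaidya_rateM.
move=> /worst_case_Theta[k [K [N [k0 K0 kK]]]].
(* The size [m * s] is bounded on one side by [k] and the size [s] on the other by [K], or
   conversely; multiplicativity of the rate leaves these quotients. *)
exists (k / K), (K / k), N; rewrite !divr_gt0//; split=> // I Ns.
rewrite /worst_run_cost sum_oc_programs sum_mpc_programs.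
set m := n_samples I; set s := step_size I in Ns *.
(* Since [m] is at least 1, a threshold on [s] alone puts both sizes in the range of the Theta
   bounds. *)
have Nms : (N <= m * s)%N by rewrite (leq_trans Ns)// leq_pmull// n_samples_gt0.
have /andP[ks sK] := kK s Ns; have /andP[kms msK] := kK (m * s)%N Nms.
(* Regrouping merges [m^(3/2)] with the number [m] of MPC programs into the rate of [m]. *)
rewrite -!(mulrA _ _ (m%:R * _)) !(mulrA (m%:R `^ _)) -vaidya_rate_split.
apply/andP; split.
  apply: le_trans kms; rewrite -mulrA ler_pM2l// vaidya_rateM.
  by rewrite mulrCA ler_wpM2l ?vaidya_rate_ge0// ler_pdivrMl.
apply: (le_trans msK); rewrite -mulrA ler_pM2l// vaidya_rateM.
by rewrite mulrCA ler_wpM2l ?vaidya_rate_ge0// ler_pdivlMl.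
Qed.
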